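(* Let $\boldsymbol f\in[L^2(0,T)]^d$, $\hat{\boldsymbol u}_0,\hat{\boldsymbol u}_1\in\mathbb R^d$, and let $\boldsymbol z_{DG}\in\mathcal V_{DG}^{\boldsymbol r}$ be the solution of $\mathcal A(\boldsymbol z_{DG},\boldsymbol v)=\mathcal F(\boldsymbol v)$ for all $\boldsymbol v\in\mathcal V_{DG}^{\boldsymbol r}$. Then $$|||\boldsymbol z_{DG}|||\lesssim\Big(\sum_{n=1}^N\|L^{-\frac12}\boldsymbol f\|_{L^2(I_n)}^2+(K^{\frac12}\hat{\boldsymbol u}_0)^2+(P^{\frac12}\hat{\boldsymbol u}_1)^2\Big)^{\frac12}.$$
   Context: Data: $T>0$; $d\ge1$; $P,L,K\in\mathbb{R}^{d\times d}$ symmetric positive definite. Set $$\widetilde K=\begin{bmatrix}K&0\\ 0&P\end{bmatrix},\quad A=\begin{bmatrix}0&-K\\ K&L\end{bmatrix},\quad \widetilde L=\begin{bmatrix}0&0\\ 0&L^{1/2}\end{bmatrix}\in\mathbb{R}^{2d\times2d},\quad \boldsymbol F=[\boldsymbol 0,\boldsymbol f]^T,\quad \boldsymbol z_0=[\hat{\boldsymbol u}_0,\hat{\boldsymbol u}_1]^T.$$ Time partition: $0=t_0<t_1<\dots<t_N=T$, $I_n=(t_{n-1},t_n]$, $\Delta t_n=t_n-t_{n-1}$. For piecewise regular $\boldsymbol v$, $\boldsymbol v(t_n^{\pm})=\lim_{\epsilon\to0^\pm}\boldsymbol v(t_n+\epsilon)$ and $[\boldsymbol v]_n=\boldsymbol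 v(t_n^+)-\boldsymbol v(t_n^-)$. Also $(\boldsymbol u,\boldsymbol v)_{I}=\int_I\boldsymbol u(s)\cdot\boldsymbol v(s)\,ds$, and $(B\boldsymbol a)^2$ denotes $(B\boldsymbol a)\cdot(B\boldsymbol a)$ for a matrix $B$ and vector $\boldsymbol a$. Spaces: let $\boldsymbol r=(r_1,\dots,r_N)\in\mathbb N^N$ and let $\mathcal P^{r}(I_n)$ be the polynomials on $I_n$ of degree at most $r$. - $\mathcal V^{\boldsymbol r}=\{\boldsymbol z\in[L^2(0,T)]^{2d}:\ \boldsymbol z|_{I_n}\in[\mathcal P^{r_n}(I_n)]^{2d}\ \forall n\}$. - $\mathcal V_{CG}^{\boldsymbol r}=\{\boldsymbol z=[\boldsymbol u,\boldsymbol w]^T\in[C^0(0,T]]^{2d}:\ \boldsymbol z|_{I_n}\in[\mathcal P^{r_n}(I_n)]^{2d}\ \forall n,\ \dot{\boldsymbol u}=\boldsymbol w\}$. - $\mathcal V_{DG}^{\boldsymbol r}$ is the set of $\boldsymbol z\in\mathcal V^{\boldsymbol r}$ for which there exist a vector $\boldsymbol z(0^-)\in\mathbb R^{2d}$ and a reconstruction $\hat{\boldsymbol z}=\mathcal R(\boldsymbol z)\in\mathcal V_{CG}^{\boldsymbol r}$ such that, for all $n=1,\dots,N$, $(\hat{\boldsymbol z}',\boldsymbol v)_{I_n}=(\boldsymbol z',\boldsymbol v)_{I_n}+[\boldsymbol z]_{n-1}\cdot\boldsymbol v(t_{n-1}^+)$ for all $\boldsymbol v\in[\mathcal P^{r_n}(I_n)]^{2d}$,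 and $\hat{\boldsymbol z}(t_{n-1}^+)=\boldsymbol z(t_{n-1}^-)$. Forms: $$\mathcal A(\boldsymbol z,\boldsymbol v)=\sum_{n=1}^N\big[(\widetilde K\dot{\boldsymbol z},\boldsymbol v)_{I_n}+(A\boldsymbol z,\boldsymbol v)_{I_n}\big]+\sum_{n=1}^{N-1}\widetilde K[\boldsymbol z]_n\cdot\boldsymbol v(t_n^+)+\widetilde K\boldsymbol z(0^+)\cdot\boldsymbol v(0^+),$$ $$\mathcal F(\boldsymbol v)=\sum_{n=1}^N(\boldsymbol F,\boldsymbol v)_{I_n}+\widetilde K\boldsymbol z_0\cdot\boldsymbol v(0^+).$$ Energy norm: $$|||\boldsymbol z|||^2=\sum_{n=1}^N\|\widetilde L\boldsymbol z\|_{L^2(I_n)}^2+\tfrac12(\widetilde K^{1/2}\boldsymbol z(0^+))^2+\tfrac12\sum_{n=1}^{N-1}(\widetilde K^{1/2}[\boldsymbol z]_n)^2+\tfrac12(\widetilde K^{1/2}\boldsymbol z(T^-))^2.$$ $a\lesssim b$ means $a\le Cb$ with a constant $C>0$ independent of the data $\boldsymbol f,\hat{\boldsymbol u}_0,\hat{\boldsymbol u}_1$ and of the discretization parameters $\Delta t_n$, $r_n$. *)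

(* Defs.v *)
From HB Require Import structures.
From mathcomp Require Import all_boot all_order all_algebra.
From mathcomp Require Import all_classical all_reals all_analysis.

Set Implicit Arguments.
Unset Strict Implicit.
Unset Printing Implicit Defensive.

Import Order.TTheory GRing.Theory Num.Theory.
Import numFieldNormedType.Exports.

Local Open Scope classical_set_scope.
Local Open Scope ring_scope.

Definition dotv (R : realType) (m : nat) (a b : 'cV[R]_m) : R :=
  (a^T *m b) 0 0.

Definition sqv (R : realType) (m : nat) (a : 'cV[R]_m) : R := dotv a a.

Definition spd (R : realType) (m : nat) (M : 'M[R]_m) : Prop :=
  M^T = M /\ forall x : 'cV[R]_m, x != 0 -> 0 < dotv x (M *m x).

(* A symmetric positive definite M has exactly one symmetric positive definite
   square root; for other M the value is irrelevant. *)
Definition mxsqrt (R : realType) (m : nat) (M : 'M[R]_m) : 'M[R]_m :=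
  xget 0 [set S : 'M[R]_m | spd S /\ S *m S = M].

(* 0 = t_0 < t_1 < ... < t_N = T; the values t n for n > N are never used. *)
Definition is_partition (R : realType) (T : R) (N : nat) (t : nat -> R) : Prop :=
  [/\ t 0%N = 0, t N = T
    & forall n : nat, (1 <= n <= N)%N -> t n.-1 < t n].

(* I_n = (t_{n-1}, t_n], for 1 <= n <= N *)
Definition Itv (R : realType) (t : nat -> R) (n : nat) : set R :=
  `]t n.-1, t n].

Definition limr (R : realType) (m : nat) (v : R -> 'cV[R]_m) (a : R) : 'cV[R]_m :=
  \col_i lim (v x i 0 @[x --> a^'+]).

Definition liml (R : realType) (m : nat) (v : R -> 'cV[R]_m) (a : R) : 'cV[R]_m :=
  \col_i lim (v x i 0 @[x --> a^'-]).

Definition jump (R : realType) (m : nat) (v : R -> 'cV[R]_m) (a : R) : 'cV[R]_m :=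
  limr v a - liml v a.

(* On a piecewise polynomial this is the piecewise derivative off the nodes;
   the nodes are a null set and derivatives only occur under integrals. *)
Definition derivv (R : realType) (m : nat) (v : R -> 'cV[R]_m) : R -> 'cV[R]_m :=
  fun x => \col_i derive1 (fun s : R => v s i 0) x.

Definition L2ip (R : realType) (m : nat) (I : set R) (u v : R -> 'cV[R]_m) : R :=
  \int[@lebesgue_measure R]_(s in I) dotv (u s) (v s).

Definition L2normsq (R : realType) (m : nat) (I : set R) (v : R -> 'cV[R]_m) : R :=
  L2ip I v v.

Definition inL2 (R : realType) (m : nat) (T : R) (v : R -> 'cV[R]_m) : Prop :=
  forall i : 'I_m,
    measurable_fun `]0, T[ (fun s => v s i 0) /\
    (@lebesgue_measure R).-integrable `]0, T[ (fun s => ((v s i 0) ^+ 2)%:E).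

(* v|_I belongs to [P^r(I)]^m *)
Definition poly_on (R : realType) (m r : nat) (I : set R) (v : R -> 'cV[R]_m)
  : Prop :=
  exists q : 'I_m -> {poly R}, forall i : 'I_m,
    (size (q i) <= r.+1)%N /\ forall s : R, I s -> v s i 0 = (q i).[s].

Definition Vr (R : realType) (m : nat) (T : R) (N : nat) (t : nat -> R)
    (r : nat -> nat) (z : R -> 'cV[R]_m) : Prop :=
  inL2 T z /\
  forall n : nat, (1 <= n <= N)%N -> poly_on (r n) (Itv t n) z.

(* z = [u, w]^T with u = usubmx z and w = dsubmx z *)
Definition V_CG (R : realType) (d : nat) (T : R) (N : nat) (t : nat -> R)
    (r : nat -> nat) (z : R -> 'cV[R]_(d + d)) : Prop :=
  [/\ forall i : 'I_(d + d), {within `]0, T], continuous (fun s => z s i 0)},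
      forall n : nat, (1 <= n <= N)%N -> poly_on (r n) (Itv t n) z
    & forall (i : 'I_d) (s : R), 0 < s < T ->
        is_derive s 1 (fun x : R => usubmx (z x) i 0) (dsubmx (z s) i 0)].

(* z(t_n^-), with the prescribed value zm = z(0^-) at n = 0 *)
Definition lval (R : realType) (m : nat) (t : nat -> R) (zm : 'cV[R]_m)
    (z : R -> 'cV[R]_m) (n : nat) : 'cV[R]_m :=
  if n is 0%N then zm else liml z (t n).

Definition is_reconstruction (R : realType) (m : nat) (N : nat) (t : nat -> R)
    (r : nat -> nat) (zm : 'cV[R]_m) (z zh : R -> 'cV[R]_m) : Prop :=
  forall n : nat, (1 <= n <= N)%N ->
    (forall v : R -> 'cV[R]_m, poly_on (r n) (Itv t n) v ->
      L2ip (Itv t n) (derivv zh) v =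
      L2ip (Itv t n) (derivv z) v
      + dotv (limr z (t n.-1) - lval t zm z n.-1) (limr v (t n.-1))) /\
    limr zh (t n.-1) = lval t zm z n.-1.

Definition V_DG (R : realType) (d : nat) (T : R) (N : nat) (t : nat -> R)
    (r : nat -> nat) (z : R -> 'cV[R]_(d + d)) : Prop :=
  Vr T N t r z /\
  exists (zm : 'cV[R]_(d + d)) (zh : R -> 'cV[R]_(d + d)),
    V_CG T N t r zh /\ is_reconstruction N t r zm z zh.

Definition Ktilde (R : realType) (d : nat) (K P : 'M[R]_d) : 'M[R]_(d + d) :=
  block_mx K 0 0 P.

Definition Amx (R : realType) (d : nat) (K L : 'M[R]_d) : 'M[R]_(d + d) :=
  block_mx 0 (- K) K L.

Definition Ltilde (R : realType) (d : nat) (L : 'M[R]_d) : 'M[R]_(d + d) :=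
  block_mx 0 0 0 (mxsqrt L).

Definition formA (R : realType) (d : nat) (P L K : 'M[R]_d) (N : nat)
    (t : nat -> R) (z v : R -> 'cV[R]_(d + d)) : R :=
  \sum_(1 <= n < N.+1)
    (L2ip (Itv t n) (fun s => Ktilde K P *m derivv z s) v
     + L2ip (Itv t n) (fun s => Amx K L *m z s) v)
  + \sum_(1 <= n < N) dotv (Ktilde K P *m jump z (t n)) (limr v (t n))
  + dotv (Ktilde K P *m limr z 0) (limr v 0).

Definition formF (R : realType) (d : nat) (P K : 'M[R]_d) (N : nat)
    (t : nat -> R) (f : R -> 'cV[R]_d) (u0 u1 : 'cV[R]_d)
    (v : R -> 'cV[R]_(d + d)) : R :=
  \sum_(1 <= n < N.+1) L2ip (Itv t n) (fun s => col_mx 0 (f s)) v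
  + dotv (Ktilde K P *m col_mx u0 u1) (limr v 0).

Definition energy_norm (R : realType) (d : nat) (P L K : 'M[R]_d) (T : R)
    (N : nat) (t : nat -> R) (z : R -> 'cV[R]_(d + d)) : R :=
  Num.sqrt
    (\sum_(1 <= n < N.+1) L2normsq (Itv t n) (fun s => Ltilde L *m z s)
     + 2^-1 * sqv (mxsqrt (Ktilde K P) *m limr z 0)
     + 2^-1 * \sum_(1 <= n < N) sqv (mxsqrt (Ktilde K P) *m jump z (t n))
     + 2^-1 * sqv (mxsqrt (Ktilde K P) *m liml z T)).

Definition data_norm (R : realType) (d : nat) (P L K : 'M[R]_d)
    (N : nat) (t : nat -> R) (f : R -> 'cV[R]_d) (u0 u1 : 'cV[R]_d) : R :=
  Num.sqrt
    (\sum_(1 <= n < N.+1)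
       L2normsq (Itv t n) (fun s => invmx (mxsqrt L) *m f s)
     + sqv (mxsqrt K *m u0) + sqv (mxsqrt P *m u1)).

(* Main.v *)
Require Import Defs.
From HB Require Import structures.
From mathcomp Require Import all_boot all_order all_algebra.
From mathcomp Require Import spectral complex.
From mathcomp Require Import all_classical all_reals all_analysis.
From mathcomp Require Import measurable_realfun ring lra.
Import Order.TTheory GRing.Theory Num.Theory.
Import numFieldNormedType.Exports.
Local Open Scope ring_scope.

(** The estimate is an energy argument: the solution is an admissible test
function for its own equation, so A(z, z) = F(z), and both sides are compared
with the energy norm.

On the left there is equality, A(z, z) = |||z|||^2 (formA_diag).  The two
coupling blocks K of the matrix A cancel because K is symmetric, so A z . z is
the square of Ltilde z (dotv_Amx).  Write E(x) = Ktilde x . x.  On each I_n the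
solution is a polynomial and Ktilde is symmetric, hence Ktilde z' . z is the
derivative of E(z)/2 and integrates to boundary values (L2ip_mul_derivv).  The
identity Ktilde (a - b) . a = E(a)/2 + E(a - b)/2 - E(b)/2 turns the jump terms
into the squares of the norm, and the boundary values telescope
(sum_energy_jumps).

On the right, f . w is the dot product of L^(-1/2) f with L^(1/2) w; applying
Young's inequality to it and to the initial term gives
F(z) <= D^2 + |||z|||^2 / 2, where D is the norm of the data (formF_le).
Absorbing the last term yields |||z|||^2 <= 2 D^2, so the constant 2 works
for every partition and every choice of degrees.

The square roots in both norms are defined by choice, so the argument needs
their existence (spd_sqrt_exists).  It comes from the spectral theorem over the
complex numbers: a real polynomial that vanishes at the eigenvalues of a real
symmetric M annihilates M.  Interpolating the fourth root at the eigenvalues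
gives a symmetric Q = p(M) with Q^4 = M, and Q^2 is the required root; passing
through the fourth root makes its positivity immediate, since
x . Q^2 x = |Q x|^2. *)

Set Implicit Arguments.
Unset Strict Implicit.
Unset Printing Implicit Defensive.

Local Open Scope classical_set_scope.
Local Open Scope ring_scope.

(** * Dot products *)

Lemma dotvE (R : realType) m (a b : 'cV[R]_m) : dotv a b = \sum_i a i 0 * b i 0.
Proof. by rewrite /dotv mxE; apply: eq_bigr => i _; rewrite mxE. Qed.

Lemma dotvC (R : realType) m (a b : 'cV[R]_m) : dotv a b = dotv b a.
Proof. by rewrite !dotvE; apply: eq_bigr => i _; rewrite mulrC. Qed.

Lemma dotv_trmx (R : realType) m (S : 'M[R]_m) (a b : 'cV[R]_m) :
  dotv (S *m a) b = dotv a (S^T *m b).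
Proof. by rewrite /dotv trmx_mul mulmxA. Qed.

Lemma dotvDl (R : realType) m (a b c : 'cV[R]_m) :
  dotv (a + b) c = dotv a c + dotv b c.
Proof. by rewrite /dotv linearD mulmxDl mxE. Qed.

Lemma dotvZl (R : realType) m k (a c : 'cV[R]_m) :
  dotv (k *: a) c = k * dotv a c.
Proof. by rewrite /dotv linearZ -scalemxAl mxE. Qed.

Lemma dotvBl (R : realType) m (a b c : 'cV[R]_m) :
  dotv (a - b) c = dotv a c - dotv b c.
Proof. by rewrite dotvDl -scaleN1r dotvZl mulN1r. Qed.

Lemma dotvBr (R : realType) m (a b c : 'cV[R]_m) :
  dotv c (a - b) = dotv c a - dotv c b.
Proof. by rewrite dotvC dotvBl !(dotvC c). Qed.

Lemma dotvZr (R : realType) m k (a c : 'cV[R]_m) :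
  dotv c (k *: a) = k * dotv c a.
Proof. by rewrite dotvC dotvZl dotvC. Qed.

Lemma dotv_symC (R : realType) m (M : 'M[R]_m) (a b : 'cV[R]_m) :
  M^T = M -> dotv (M *m a) b = dotv (M *m b) a.
Proof. by move=> Msym; rewrite dotv_trmx Msym dotvC. Qed.

Lemma dotv_col_mx (R : realType) m n (a b : 'cV[R]_m) (c d : 'cV[R]_n) :
  dotv (col_mx a c) (col_mx b d) = dotv a b + dotv c d.
Proof. by rewrite /dotv tr_col_mx mul_row_col mxE. Qed.

Lemma sqv_ge0 (R : realType) m (a : 'cV[R]_m) : 0 <= sqv a.
Proof. by rewrite /sqv dotvE sumr_ge0 // => i _; rewrite -expr2 sqr_ge0. Qed.

Lemma sqv_gt0 (R : realType) m (a : 'cV[R]_m) : a != 0 -> 0 < sqv a.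
Proof.
apply: contraNT; rewrite -leNgt => a_le0; apply/eqP/colP => i.
have /eqP : sqv a = 0 by apply/eqP; rewrite eq_le a_le0 sqv_ge0.
rewrite /sqv dotvE psumr_eq0 => [/allP/(_ i)|j _]; last first.
  by rewrite -expr2 sqr_ge0.
rewrite mem_index_enum => /(_ isT) /implyP/(_ isT).
by rewrite mulf_eq0 orbb mxE => /eqP.
Qed.

(** * Square roots of positive definite matrices *)

Lemma spd_unitmx (R : realType) m (M : 'M[R]_m) : spd M -> M \in unitmx.
Proof.
move=> [_ Mpos]; rewrite -unitmx_tr -row_free_unit; apply/inj_row_free => v vM0.
apply: contraTeq isT => v_neq0.
have := Mpos v^T; rewrite trmx_eq0 => /(_ v_neq0).
by rewrite -[M]trmxK -trmx_mul vM0 trmx0 /dotv mulmx0 mxE ltxx.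
Qed.

Lemma spd_sqr (R : realType) m (Q : 'M[R]_m) :
  Q^T = Q -> Q \in unitmx -> spd (Q *m Q).
Proof.
move=> Qsym Qunit; split; first by rewrite trmx_mul Qsym.
move=> x x_neq0; rewrite -mulmxA -{1}Qsym -dotv_trmx; apply: sqv_gt0.
by apply: contra x_neq0 => /eqP Qx0; rewrite -(mulKmx Qunit x) Qx0 mulmx0.
Qed.

(** The sample points need not be distinct, so eigenvalues can be listed with
multiplicity. *)
Lemma poly_interpolation (F : fieldType) (s : seq F) (g : F -> F) :
  exists p : {poly F}, {in s, forall x, p.[x] = g x}.
Proof.
elim: s => [|a s [p pg]]; first by exists 0.
have [as_|a_s] := boolP (a \in s).
  by exists p => x; rewrite inE => /predU1P[->|]; exact: pg.
pose w : {poly F} := \prod_(x <- s) ('X - x%:P).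
have wa_neq0 : w.[a] != 0 by rewrite -[_ == 0]/(root w a) root_prod_XsubC.
exists (p + ((g a - p.[a]) / w.[a]) *: w) => x; rewrite inE !hornerE.
have [->|_ /= xs] := eqVneq x a; first by rewrite divfK // subrKC.
have /eqP -> : w.[x] == 0 by rewrite -[_ == 0]/(root w x) root_prod_XsubC.
by rewrite mulr0 addr0 pg.
Qed.

(** Over the complex numbers M is unitarily similar to a diagonal matrix with
real entries; s lists these entries, and p(M) is similar to the diagonal matrix
of the values of p on s. *)
Lemma symmetric_real_spectrum (R : realType) m (M : 'M[R]_m.+1) : M^T = M ->
  exists2 s : seq R, {in s, forall a, eigenvalue M a} &
    forall p : {poly R}, {in s, forall a, p.[a] = 0} -> horner_mx M p = 0.
Proof.
move=> Msym.
pose toC : {rmorphism R -> R[i]} := real_complex R.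
pose MC := map_mx toC M.
have MCherm : MC \is hermsymmx.
  apply/is_hermitianmxP; rewrite expr0 scale1r; apply/matrixP => i j.
  rewrite !mxE conj_Creal; last by rewrite complex_real.
  by rewrite -[in RHS]Msym mxE.
have /orthomx_spectralP MCspec := hermitian_normalmx MCherm.
have Dreal := hermitian_spectral_diag_real MCherm.
move: MCspec Dreal; set U := spectralmx MC; set D := spectral_diag MC.
move=> MCspec Dreal.
have Uunit : U \in unitmx := spectral_unit MC.
have DE i : D 0 i = toC (complex.Re (D 0 i)).
  by have /mxOverP/(_ 0 i)/complex_realP[x ->] := Dreal.
exists [seq complex.Re (D 0 i) | i <- enum 'I_m.+1].
  move=> _ /mapP[i _ ->]; rewrite -(eigenvalue_map toC) -DE.
  apply/eigenvalueP; exists (row i U).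
    rewrite -row_mul; suff -> : U *m MC = diag_mx D *m U.
      by rewrite row_mul row_diag_mx -scalemxAl -rowE.
    by rewrite {1}MCspec !mulmxA mulmxV // mul1mx.
  apply: contraTneq Uunit => Ui0; rewrite unitmxE (expand_det_row _ i) big1.
    by rewrite unitr0.
  by move=> j _; have /rowP/(_ j) := Ui0; rewrite !mxE => ->; rewrite mul0r.
move=> p p0; apply: (map_mx_inj (f := toC)); rewrite map_mx0 map_horner_mx.
rewrite -/MC MCspec horner_mx_uconjC // horner_mx_diag.
suff -> : map_mx (horner (map_poly toC p)) D = 0.
  by rewrite linear0 mulmx0 mul0mx.
apply/rowP => i; rewrite !mxE DE horner_map p0 ?rmorph0 //.
by apply/mapP; exists i; rewrite ?mem_enum.
Qed.

Lemma spd_eigenvalue_gt0 (R : realType) m (M : 'M[R]_m) a :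
  spd M -> eigenvalue M a -> 0 < a.
Proof.
move=> [Msym Mpos] /eigenvalueP[v vM v_neq0].
have := Mpos v^T; rewrite trmx_eq0 => /(_ v_neq0).
rewrite -{1}Msym -trmx_mul vM linearZ /= /dotv -scalemxAr mxE => av_gt0.
by move: av_gt0; rewrite pmulr_lgt0 // sqv_gt0 // trmx_eq0.
Qed.

Lemma trmx_horner_mx (R : comNzRingType) m (M : 'M[R]_m.+1) (p : {poly R}) :
  (horner_mx M p)^T = horner_mx M^T p.
Proof.
elim/poly_ind: p => [|p c IHp]; first by rewrite !rmorph0 trmx0.
rewrite !rmorphD !rmorphM /= !horner_mx_X !horner_mx_C linearD /= tr_scalar_mx.
by rewrite trmx_mul IHp; congr (_ + _); apply: comm_mx_horner.
Qed.

(** The root is p(M)^2, where p interpolates the fourth root on the spectrum. *)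
Theorem spd_sqrt_exists (R : realType) m (M : 'M[R]_m) :
  spd M -> exists S : 'M[R]_m, spd S /\ S *m S = M.
Proof.
case: m M => [|m] M Mspd.
  (* all matrices of size 0 are equal *)
  by exists M; split=> //; rewrite [RHS]flatmx0; apply: flatmx0.
have [s s_eig s_ann] := symmetric_real_spectrum Mspd.1.
have [p pE] := poly_interpolation s (fun x => Num.sqrt (Num.sqrt x)).
pose Q := horner_mx M p.
have Q4 : (Q *m Q) *m (Q *m Q) = M.
  have : horner_mx M (p ^+ 4 - 'X) = 0.
    apply: s_ann => a a_s; rewrite !hornerE pE //.
    have /ltW a_ge0 := spd_eigenvalue_gt0 Mspd (s_eig _ a_s).
    by rewrite (exprM _ 2 2) !sqr_sqrtr ?sqrtr_ge0 // subrr.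
  rewrite rmorphB rmorphXn /= horner_mx_X => /eqP; rewrite subr_eq0 => /eqP.
  by rewrite (exprM _ 2 2) !expr2 !mulmxE.
exists (Q *m Q); split=> //; apply: spd_sqr.
  by rewrite /Q trmx_horner_mx Mspd.1.
have := spd_unitmx Mspd; rewrite -Q4 !unitmx_mul.
by case: (Q \in unitmx).
Qed.

Lemma mxsqrtP (R : realType) m (M : 'M[R]_m) :
  spd M -> (mxsqrt M)^T = mxsqrt M /\ mxsqrt M *m mxsqrt M = M.
Proof.
move=> /spd_sqrt_exists[S SP]; rewrite /mxsqrt.
pose roots := [set S : 'M[R]_m | spd S /\ S *m S = M].
by have [[]] := @xgetPex _ 0 roots (ex_intro _ S SP).
Qed.

Lemma sqv_mxsqrt (R : realType) m (M : 'M[R]_m) (x : 'cV[R]_m) :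
  spd M -> sqv (mxsqrt M *m x) = dotv (M *m x) x.
Proof.
by move=> /mxsqrtP[Ssym S2]; rewrite /sqv dotv_trmx Ssym mulmxA S2 dotvC.
Qed.

Lemma spd_Ktilde (R : realType) d (K P : 'M[R]_d) :
  spd K -> spd P -> spd (Ktilde K P).
Proof.
have nneg (M : 'M[R]_d) x : spd M -> 0 <= dotv x (M *m x).
  move=> [_ Mpos]; have [->|/Mpos/ltW //] := eqVneq x 0.
  by rewrite mulmx0 /dotv mulmx0 mxE.
move=> Kspd Pspd; split.
  by rewrite /Ktilde tr_block_mx !trmx0 Kspd.1 Pspd.1.
move=> x; rewrite -[x]vsubmxK /Ktilde mul_block_col !mul0mx addr0 add0r.
rewrite dotv_col_mx col_mx_eq0 negb_and => /orP[u_neq0|w_neq0].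
  by rewrite ltr_wpDr ?nneg // Kspd.2.
by rewrite ltr_wpDl ?nneg // Pspd.2.
Qed.

(** Expand the nonnegative energy of x - y / 2.  The factor 1/4 is half the
weight that the initial value carries in the squared energy norm. *)
Lemma spd_young (R : realType) m (M : 'M[R]_m) (x y : 'cV[R]_m) : spd M ->
  dotv (M *m x) y <= dotv (M *m x) x + 4^-1 * dotv (M *m y) y.
Proof.
move=> Mspd; have := sqv_ge0 (mxsqrt M *m (x - 2^-1 *: y)).
rewrite sqv_mxsqrt // mulmxBr -scalemxAr !(dotvBl, dotvBr, dotvZl, dotvZr).
rewrite (dotv_symC y x Mspd.1); lra.
Qed.

Lemma sqv_young (R : realType) m (x y : 'cV[R]_m) :
  dotv x y <= 2^-1 * sqv x + 2^-1 * sqv y.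
Proof.
have := sqv_ge0 (x - y).
rewrite /sqv !(dotvBl, dotvBr) (dotvC y x); lra.
Qed.

(** * Square-integrable vector functions *)

Section L2.
Variable R : realType.
Local Notation mu := (@lebesgue_measure R).

Definition sqint (I : set R) (g : R -> R) : Prop :=
  measurable_fun I g /\ mu.-integrable I (fun s => (g s ^+ 2)%:E).

Definition L2on m (I : set R) (v : R -> 'cV[R]_m) : Prop :=
  forall i, sqint I (fun s => v s i 0).

(** |f g| <= f^2 + g^2. *)
Lemma sqint_mul_integrable (I : set R) (f g : R -> R) : measurable I ->
  sqint I f -> sqint I g -> mu.-integrable I (fun s => (f s * g s)%:E).
Proof.
move=> mI [mf f2] [mg g2].
apply: (@le_integrable _ _ _ mu I mI _
  (fun s => (f s ^+ 2)%:E + (g s ^+ 2)%:E)%E).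
- exact/measurable_EFinP/measurable_funM.
- move=> s _; rewrite -EFinD !abse_EFin lee_fin.
  rewrite [leRHS]ger0_norm ?addr_ge0 ?sqr_ge0 // ler_norml.
  by apply/andP; split; nra.
- exact: integrableD.
Qed.

Lemma sqint0 (I : set R) : sqint I (fun=> 0).
Proof. by split => //; under eq_fun do rewrite expr0n; apply: integrable0. Qed.

Lemma sqintZ (I : set R) c f : measurable I ->
  sqint I f -> sqint I (fun s => c * f s).
Proof.
move=> mI [mf f2]; split; first exact: measurable_funM.
under eq_fun do rewrite exprMn EFinM.
exact: (@integrableZl _ _ _ mu I mI).
Qed.

Lemma sqintD (I : set R) f g : measurable I ->
  sqint I f -> sqint I g -> sqint I (fun s => f s + g s).
Proof.
move=> mI sf sg; split; first exact: (measurable_funD sf.1 sg.1).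
have fg := sqint_mul_integrable mI sf sg.
under eq_fun do rewrite sqrrD -mulr_natl 2!EFinD.
apply: integrableD => //; last exact: sg.2.
apply: integrableD => //; first exact: sf.2.
under eq_fun do rewrite EFinM.
exact: (@integrableZl _ _ _ mu I mI).
Qed.

Lemma L2on_mulmx (I : set R) m n (M : 'M[R]_(m, n)) (v : R -> 'cV[R]_n) :
  measurable I -> L2on I v -> L2on I (fun s => M *m v s).
Proof.
move=> mI vI i; under eq_fun do rewrite mxE.
elim: (index_enum _) => [|j js IHjs].
  by under eq_fun do rewrite big_nil; exact: sqint0.
by under eq_fun do rewrite big_cons; apply: sqintD => //; apply: sqintZ.
Qed.

Lemma integrable_dotv (I : set R) m (u v : R -> 'cV[R]_m) : measurable I ->
  L2on I u -> L2on I v ->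
  mu.-integrable I (EFin \o (fun s => dotv (u s) (v s))).
Proof.
move=> mI uI vI; rewrite /comp; under eq_fun do rewrite dotvE -sumEFin.
by apply: integrable_sum => // i _; apply: sqint_mul_integrable.
Qed.

(** The data are square integrable on the open interval ]0, T[; the last cell of
a partition also contains T, which is harmless because a point has measure
zero. *)
Lemma inL2_L2on m T (v : R -> 'cV[R]_m) (a b : R) : 0 <= a -> b <= T ->
  inL2 T v -> L2on `]a, b] v.
Proof.
move=> a_ge0 b_leT vL2 i; have [mv v2] := vL2 i.
have sub : `]a, b] `<=` `]0, T].
  by apply: subset_itv; rewrite bnd_simp.
split.
  by apply: measurable_funS sub _ => //; apply/measurable_fun_itv_bndo_bndcP.
apply: (@integrableS _ _ _ mu _ _ _ _ _ sub) => //; apply/integrableP.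
have [mv2 v2oo] := integrableP _ _ _ v2.
split; first exact/emeasurable_fun_itv_bndo_bndcP.
by rewrite -integral_itv_bndo_bndc //; apply: measurableT_comp.
Qed.

End L2.

(** * Polynomial vector functions on an interval *)

Section PiecewisePolynomial.
Variable R : realType.
Local Notation mu := (@lebesgue_measure R).

Definition pval m (p : 'I_m -> {poly R}) (s : R) : 'cV[R]_m := \col_i (p i).[s].

Lemma Rintegral_deriv (Q : {poly R}) (a b : R) : a < b ->
  \int[mu]_(s in `]a, b[) Q^`().[s] = Q.[b] - Q.[a].
Proof.
move=> ab.
have intQ : mu.-integrable `[a, b] (EFin \o horner Q^`()).
  apply: continuous_compact_integrable; first exact: segment_compact.
  by apply: continuous_subspaceT; exact: continuous_horner.
rewrite Rintegral_itv_bndo_bndc; last first.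
  by apply: integrableS intQ => //; apply: subset_itv; rewrite bnd_simp.
rewrite Rintegral_itv_obnd_cbnd; last first.
  by apply: integrableS intQ => //; apply: subset_itv; rewrite bnd_simp.
rewrite /Rintegral (continuous_FTC2 (F := horner Q)) //.
- by apply: continuous_subspaceT; exact: continuous_horner.
- split; first by move=> x _; exact: derivable_horner.
    by apply: cvg_at_right_filter; exact: continuous_horner.
  by apply: cvg_at_left_filter; exact: continuous_horner.
- by move=> x _; rewrite -derivE.
Qed.

(** The energy M p . p / 2 as a polynomial in time, so that the fundamental
theorem of calculus is only needed for polynomials. *)
Definition quad_poly m (M : 'M[R]_m) (p : 'I_m -> {poly R}) : {poly R} :=
  2^-1 *: \sum_i \sum_j M i j *: (p j * p i).

Lemma horner_quad_poly m (M : 'M[R]_m) p s :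
  (quad_poly M p).[s] = 2^-1 * dotv (M *m pval p s) (pval p s).
Proof.
rewrite /quad_poly hornerZ horner_sum dotvE; congr (_ * _).
apply: eq_bigr => i _; rewrite horner_sum !mxE big_distrl.
apply: eq_bigr => j _.
by rewrite hornerZ hornerM !mxE /= mulrA.
Qed.

(** The product rule gives two double sums, equal to each other by symmetry
of M. *)
Lemma horner_deriv_quad_poly m (M : 'M[R]_m) p s : M^T = M ->
  (quad_poly M p)^`().[s] = dotv (M *m pval (fun i => (p i)^`()) s) (pval p s).
Proof.
move=> Msym; rewrite /quad_poly derivZ hornerZ.
have -> : dotv (M *m pval (fun i => (p i)^`()) s) (pval p s)
   = \sum_i \sum_j M i j * ((p j)^`().[s] * (p i).[s]).
  rewrite dotvE; apply: eq_bigr => i _; rewrite !mxE big_distrl.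
  apply: eq_bigr => j _.
  by rewrite !mxE /= -mulrA.
set X := RHS.
suff -> : (\sum_i \sum_j M i j *: (p j * p i))^`().[s] = X + X by field.
have XC : X = \sum_i \sum_j M i j * ((p i)^`().[s] * (p j).[s]).
  rewrite /X exchange_big; apply: eq_bigr => i _; apply: eq_bigr => j _.
  by rewrite -{1}Msym mxE.
rewrite {2}XC /X -big_split raddf_sum horner_sum.
apply: eq_bigr => i _; rewrite raddf_sum horner_sum -big_split /=.
by apply: eq_bigr => j _; rewrite derivZ derivM hornerZ hornerD !hornerM; ring.
Qed.

(** The pointwise derivative of z may be arbitrary at the endpoint b, where z
need not be differentiable, so the identification with the derivative of the
energy polynomial takes place on the open interval. *)
Lemma L2ip_mul_derivv m (M : 'M[R]_m) (p : 'I_m -> {poly R}) (z : R -> 'cV[R]_m)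
    (a b : R) :
  M^T = M -> a < b -> (forall s, s \in `]a, b] -> z s = pval p s) ->
  L2ip `]a, b] (fun s => M *m derivv z s) z =
  2^-1 * dotv (M *m pval p b) (pval p b)
  - 2^-1 * dotv (M *m pval p a) (pval p a).
Proof.
move=> Msym ab zp; rewrite -!horner_quad_poly -Rintegral_deriv // /L2ip.
have zE s : s \in `]a, b[ ->
    dotv (M *m derivv z s) (z s) = (quad_poly M p)^`().[s].
  move=> s_ab; rewrite horner_deriv_quad_poly // zp; last first.
    by apply: subset_itv s_ab; rewrite bnd_simp.
  congr (dotv (M *m _) _); apply/colP => i; rewrite !mxE derivE.
  rewrite !derive1E; apply: near_eq_derive => //.
  have := near_in_itvoo s_ab; apply: filterS => x x_ab.
  by rewrite zp ?mxE //; apply: subset_itv x_ab; rewrite bnd_simp.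
rewrite -Rintegral_itv_bndo_bndc.
  by apply: eq_Rintegral => s /set_mem/zE.
have intQ : mu.-integrable `[a, b] (EFin \o horner (quad_poly M p)^`()).
  apply: continuous_compact_integrable; first exact: segment_compact.
  by apply: continuous_subspaceT; exact: continuous_horner.
apply: (@eq_integrable _ _ _ mu _ _ (EFin \o horner (quad_poly M p)^`())) => //.
  by move=> s /set_mem/zE /= ->.
by apply: integrableS intQ => //; apply: subset_itv; rewrite bnd_simp.
Qed.

Lemma limr_pval m (p : 'I_m -> {poly R}) (z : R -> 'cV[R]_m) (a b : R) :
  a < b -> (forall s, s \in `]a, b] -> z s = pval p s) -> limr z a = pval p a.
Proof.
move=> ab zp; apply/colP => i; rewrite !mxE.
have pa : (p i).[x] @[x --> a^'+] --> (p i).[a].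
  by apply: cvg_at_right_filter; exact: continuous_horner.
apply: cvg_lim => //; apply: cvg_trans pa; apply: near_eq_cvg.
near=> x; rewrite zp ?mxE //= in_itv /=; apply/andP; split; near: x.
  exact: nbhs_right_gt.
exact: nbhs_right_le.
Unshelve. all: by end_near. Qed.

Lemma liml_pval m (p : 'I_m -> {poly R}) (z : R -> 'cV[R]_m) (a b : R) :
  a < b -> (forall s, s \in `]a, b] -> z s = pval p s) -> liml z b = pval p b.
Proof.
move=> ab zp; apply/colP => i; rewrite !mxE.
have pa : (p i).[x] @[x --> b^'-] --> (p i).[b].
  by apply: cvg_at_left_filter; exact: continuous_horner.
apply: cvg_lim => //; apply: cvg_trans pa; apply: near_eq_cvg.
near=> x; rewrite zp ?mxE //= in_itv /=; apply/andP; split; near: x.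
  exact: nbhs_left_gt.
exact: nbhs_left_le.
Unshelve. all: by end_near. Qed.

End PiecewisePolynomial.

(** * The bilinear form on the diagonal *)

Lemma Ltilde_mul (R : realType) d (L : 'M[R]_d) (z : 'cV[R]_(d + d)) :
  Ltilde L *m z = col_mx 0 (mxsqrt L *m dsubmx z).
Proof. by rewrite -{1}[z]vsubmxK /Ltilde mul_block_col !mul0mx !add0r. Qed.

Lemma sqv_Ltilde (R : realType) d (L : 'M[R]_d) (z : 'cV[R]_(d + d)) :
  sqv (Ltilde L *m z) = sqv (mxsqrt L *m dsubmx z).
Proof. by rewrite Ltilde_mul /sqv dotv_col_mx {1}/dotv mulmx0 mxE add0r. Qed.

(** The off-diagonal contributions - K w . u and K u . w cancel. *)
Lemma dotv_Amx (R : realType) d (K L : 'M[R]_d) (z : 'cV[R]_(d + d)) :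
  spd K -> spd L -> dotv (Amx K L *m z) z = sqv (Ltilde L *m z).
Proof.
move=> Kspd Lspd; rewrite sqv_Ltilde sqv_mxsqrt //.
rewrite -{1 2}[z]vsubmxK /Amx mul_block_col mul0mx add0r mulNmx dotv_col_mx.
rewrite dotvDl -scaleN1r dotvZl (dotv_symC _ _ Kspd.1); lra.
Qed.

(** With S = L^(1/2), moving S across the dot product gives
f . w = S^-1 f . S w. *)
Lemma dotv_force_le (R : realType) d (L : 'M[R]_d) (f : 'cV[R]_d)
    (z : 'cV[R]_(d + d)) : spd L ->
  dotv (col_mx 0 f) z <=
  2^-1 * sqv (invmx (mxsqrt L) *m f) + 2^-1 * sqv (Ltilde L *m z).
Proof.
move=> Lspd; have [Ssym S2] := mxsqrtP Lspd; rewrite sqv_Ltilde.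
have Sunit : mxsqrt L \in unitmx.
  by have := spd_unitmx Lspd; rewrite -{1}S2 unitmx_mul andbb.
rewrite -{1}[z]vsubmxK dotv_col_mx {1}/dotv trmx0 mul0mx mxE add0r.
by rewrite -{1}[f](mulKVmx Sunit) dotv_trmx Ssym; exact: sqv_young.
Qed.

(** Here a n and b n stand for the right and left limits at the n-th node.  Each
jump term equals E(a n)/2 + E(a n - b n)/2 - E(b n)/2, whose first and last
parts cancel the boundary values of the adjacent cells; what remains is half
the energy of a 0, of the jumps and of b N. *)
Lemma sum_energy_jumps (R : realType) m (M : 'M[R]_m)
    (a b : nat -> 'cV[R]_m) N :
  M^T = M -> (0 < N)%N ->
  let E x := dotv (M *m x) x in
  \sum_(1 <= n < N.+1) (2^-1 * E (b n) - 2^-1 * E (a n.-1))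
  + \sum_(1 <= n < N) dotv (M *m (a n - b n)) (a n) + E (a 0%N)
  = 2^-1 * E (a 0%N) + 2^-1 * \sum_(1 <= n < N) E (a n - b n) + 2^-1 * E (b N).
Proof.
move=> Msym + E; have Ejump n : dotv (M *m (a n - b n)) (a n) =
    2^-1 * E (a n) + 2^-1 * E (a n - b n) - 2^-1 * E (b n).
  rewrite /E mulmxBr !(dotvBl, dotvBr) (dotv_symC (b n) (a n) Msym).
  by field.
under [X in _ + X + _]eq_bigr do rewrite Ejump.
clearbody E; case: N => // N _; elim: N => [|N IHN].
  by rewrite big_nat1 !big_geq //=; lra.
rewrite (big_nat_recr N.+2) //=; move: IHN.
rewrite !(big_nat_recr N.+1) //=; lra.
Qed.

(** Every term of the form becomes a term of the squared energy norm, so testing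
with the solution itself loses nothing. *)
Lemma formA_diag (R : realType) d (P L K : 'M[R]_d) T N t (r : nat -> nat)
    (z : R -> 'cV[R]_(d + d)) :
  spd P -> spd L -> spd K -> 0 < T -> is_partition T N t ->
  (forall n : nat, (1 <= n <= N)%N -> poly_on (r n) (Itv t n) z) ->
  formA P L K N t z z = energy_norm P L K T N t z ^+ 2.
Proof.
move=> Pspd Lspd Kspd T_gt0 [t0 tN tlt] zpoly.
have Mspd := spd_Ktilde Kspd Pspd.
have N_gt0 : (0 < N)%N.
  by case: N tN {tlt zpoly} => // tT; rewrite -tT t0 ltxx in T_gt0.
rewrite /energy_norm sqr_sqrtr; last first.
  rewrite !addr_ge0 ?mulr_ge0 ?invr_ge0 ?sumr_ge0 ?sqv_ge0 // => n _.
    by apply: Rintegral_ge0 => s _; exact: sqv_ge0.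
  exact: sqv_ge0.
have sumK : \sum_(1 <= n < N.+1)
    L2ip (Itv t n) (fun s => Ktilde K P *m derivv z s) z =
  \sum_(1 <= n < N.+1)
    (2^-1 * dotv (Ktilde K P *m liml z (t n)) (liml z (t n))
     - 2^-1 * dotv (Ktilde K P *m limr z (t n.-1)) (limr z (t n.-1))).
  apply: eq_big_nat => n nN; have [p zp] := zpoly n nN.
  have zE s : s \in `]t n.-1, t n] -> z s = pval p s.
    by move=> s_tn; apply/colP => i; rewrite mxE (zp i).2.
  rewrite (L2ip_mul_derivv Mspd.1 (tlt n nN) zE).
  by rewrite (limr_pval (tlt n nN) zE) (liml_pval (tlt n nN) zE).
have sumA : \sum_(1 <= n < N.+1) L2ip (Itv t n) (fun s => Amx K L *m z s) z =
    \sum_(1 <= n < N.+1) L2normsq (Itv t n) (fun s => Ltilde L *m z s).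
  by apply: eq_bigr => n _; apply: eq_Rintegral => s _; exact: dotv_Amx.
rewrite /formA big_split /= sumK sumA.
have := sum_energy_jumps (fun n => limr z (t n))
  (fun n => liml z (t n)) Mspd.1 N_gt0.
rewrite /= t0 tN !sqv_mxsqrt // => E_id.
under [X in _ = _ + _ + _ * X + _]eq_bigr do rewrite sqv_mxsqrt //.
move: E_id; rewrite /jump; lra.
Qed.

(** * The load functional and the energy estimate *)

(** Young's inequality is used with weights that put at most half of the squared
energy norm on the right, so that it can be absorbed. *)
Lemma formF_le (R : realType) d (P L K : 'M[R]_d) T N t
    (f : R -> 'cV[R]_d) (u0 u1 : 'cV[R]_d) (z : R -> 'cV[R]_(d + d)) :
  spd P -> spd L -> spd K -> is_partition T N t -> inL2 T f -> inL2 T z ->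
  formF P K N t f u0 u1 z <=
  data_norm P L K N t f u0 u1 ^+ 2 + 2^-1 * energy_norm P L K T N t z ^+ 2.
Proof.
move=> Pspd Lspd Kspd [t0 tN tlt] fL2 zL2.
pose mu := @lebesgue_measure R.
have Mspd := spd_Ktilde Kspd Pspd.
have L2_ge0 m n (v : R -> 'cV[R]_m) : 0 <= L2normsq (Itv t n) v.
  by apply: Rintegral_ge0 => s _; exact: sqv_ge0.
rewrite /energy_norm /data_norm !sqr_sqrtr; last first.
- by rewrite !addr_ge0 ?sumr_ge0 ?sqv_ge0.
- rewrite !addr_ge0 ?mulr_ge0 ?invr_ge0 ?sumr_ge0 ?sqv_ge0 // => n _.
  exact: sqv_ge0.
have t_mono i j : (i <= j <= N)%N -> t i <= t j.
  move=> /andP[ij]; rewrite -(subnKC ij); elim: (j - i)%N => [|k IHk].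
    by rewrite addn0.
  rewrite addnS => kN; apply: le_trans (IHk (ltnW kN)) (ltW _).
  exact: (tlt (i + k).+1).
have sumF : \sum_(1 <= n < N.+1) L2ip (Itv t n) (fun s => col_mx 0 (f s)) z <=
  \sum_(1 <= n < N.+1)
     (2^-1 * L2normsq (Itv t n) (fun s => invmx (mxsqrt L) *m f s)
      + 2^-1 * L2normsq (Itv t n) (fun s => Ltilde L *m z s)).
  rewrite !big_nat; apply: ler_sum => n /andP[n_gt0 nN].
  have tn1 : 0 <= t n.-1 by rewrite -t0 t_mono // (leq_trans (leq_pred n)).
  have tn : t n <= T by rewrite -tN t_mono // leqnn andbT.
  have fn := inL2_L2on tn1 tn fL2; have zn := inL2_L2on tn1 tn zL2.
  have mI : measurable (Itv t n) by exact: measurable_itv.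
  have Sf := L2on_mulmx (invmx (mxsqrt L)) mI fn.
  have Lz := L2on_mulmx (Ltilde L) mI zn.
  have f0n : L2on (Itv t n) (fun s => col_mx 0 (f s) : 'cV_(d + d)).
    move=> i; rewrite -(splitK i); case: (fintype.split i) => j /=.
      by under eq_fun do rewrite col_mxEu mxE; exact: sqint0.
    by under eq_fun do rewrite col_mxEd.
  have half (g : R -> R) : mu.-integrable (Itv t n) (EFin \o g) ->
      mu.-integrable (Itv t n) (EFin \o (fun s => 2^-1 * g s)).
    by move=> gint; rewrite /comp; under eq_fun do rewrite EFinM;
      exact: (@integrableZl _ _ _ mu _ mI).
  have Sfint := integrable_dotv mI Sf Sf.
  have Lzint := integrable_dotv mI Lz Lz.
  rewrite /L2normsq /L2ip -!RintegralZl // -RintegralD //; [|exact: half..].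
  apply: le_Rintegral => //; first exact: integrable_dotv.
    rewrite /comp; under eq_fun do rewrite EFinD.
    by apply: integrableD => //; exact: half.
  by move=> s _; exact: dotv_force_le.
have sumL : 0 <= \sum_(1 <= n < N.+1)
    L2normsq (Itv t n) (fun s => Ltilde L *m z s).
  by rewrite sumr_ge0.
have initial := spd_young (col_mx u0 u1) (limr z 0) Mspd.
have z0E : dotv (Ktilde K P *m col_mx u0 u1) (col_mx u0 u1) =
    sqv (mxsqrt K *m u0) + sqv (mxsqrt P *m u1).
  rewrite !sqv_mxsqrt // /Ktilde mul_block_col !mul0mx addr0 add0r.
  exact: dotv_col_mx.
have jumps_ge0 : 0 <= \sum_(1 <= n < N)
    sqv (mxsqrt (Ktilde K P) *m jump z (t n)).
  by rewrite sumr_ge0 // => n _; exact: sqv_ge0.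
have last_ge0 := sqv_ge0 (mxsqrt (Ktilde K P) *m liml z T).
have data_ge0 : 0 <= \sum_(1 <= n < N.+1)
    L2normsq (Itv t n) (fun s => invmx (mxsqrt L) *m f s).
  by rewrite sumr_ge0.
have init_ge0 := sqv_ge0 (mxsqrt (Ktilde K P) *m limr z 0).
move: sumF init_ge0; rewrite big_split /= -!mulr_sumr.
rewrite (sqv_mxsqrt (limr z 0) Mspd).
rewrite /formF; move: initial jumps_ge0 last_ge0 data_ge0 sumL; rewrite z0E.
lra.
Qed.

Theorem proposition3 (R : realType) (T : R) (d : nat) (P L K : 'M[R]_d)
    (hT : 0 < T) (hd : (1 <= d)%N) (hP : spd P) (hL : spd L) (hK : spd K) :
  exists2 C : R, 0 < C &
    forall (N : nat) (t : nat -> R) (r : nat -> nat),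
      is_partition T N t ->
      forall (f : R -> 'cV[R]_d) (u0 u1 : 'cV[R]_d),
        inL2 T f ->
        forall zDG : R -> 'cV[R]_(d + d),
          V_DG T N t r zDG ->
          (forall v : R -> 'cV[R]_(d + d), V_DG T N t r v ->
             formA P L K N t zDG v = formF P K N t f u0 u1 v) ->
          energy_norm P L K T N t zDG <= C * data_norm P L K N t f u0 u1.
Proof.
exists 2 => // N t r tpart f u0 u1 fL2 z zV solves.
have [[zL2 zpoly] _] := zV.
have := formF_le u0 u1 hP hL hK tpart fL2 zL2.
rewrite -(solves z zV) (formA_diag hP hL hK hT tpart zpoly) => energy_le.
rewrite -ler_sqr ?nnegrE ?mulr_ge0 ?sqrtr_ge0 // exprMn.
have := sqr_ge0 (data_norm P L K N t f u0 u1); move: energy_le; lra.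
Qed.
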